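(* Let $r\ge 2$ be an integer and let $\varepsilon>0$. Then there exist $\gamma=\gamma(r,\varepsilon)>0$ and $K=K(r,\varepsilon)$ such that the following holds. Let $G=(V,E)$ be a $(\gamma,p)$-pseudorandom graph for some $p\in(0,1]$, with $|V|=n$ sufficiently large in terms of $r$ and $\varepsilon$. Then in any $r$-colouring of the edges of $G$ there exists a path of length at least $(2/(r+1)-\varepsilon)n$ in which all but at most $K$ of the edges have the same colour.
   Context: For disjoint vertex sets $U,W$ the density is $d(U,W)=|E(U,W)|/(|U||W|)$, where $E(U,W)$ is the set of edges with one endpoint in $U$ and one in $W$. For $\gamma,p\in(0,1]$, a graph $G=(V,E)$ is $(\gamma,p)$-pseudorandom if for any two disjoint $U,W\subseteq V$ with $|U|,|W|\ge\gamma|V|$ we have $|d(U,W)-p|\le\gamma p$. The length of a path is its number of edges. *)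

(* Defs.v *)
From HB Require Import structures.
From mathcomp Require Import all_boot all_order all_algebra.
From mathcomp Require Import reals.

Set Implicit Arguments.
Unset Strict Implicit.
Unset Printing Implicit Defensive.

Import Order.TTheory GRing.Theory Num.Theory.
Local Open Scope ring_scope.

(* Finite simple graphs whose vertex set is the whole of T. *)
Record sgraph (T : finType) := SGraph {
  adj :> rel T;
  adj_sym : symmetric adj;
  adj_irrefl : irreflexive adj
}.

Section Graph.
Variables (T : finType) (G : sgraph T).

Definition edges : {set {set T}} := [set [set x; y] | x in T, y in T & G x y].

Definition edges_between (U W : {set T}) : {set {set T}} :=
  [set e in edges | [exists u in U, exists w in W, e == [set u; w]]].

Definition density (R : realType) (U W : {set T}) : R :=
  #|edges_between U W|%:R / (#|U|%:R * #|W|%:R).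

Definition pseudorandom (R : realType) (gamma p : R) : Prop :=
  forall U W : {set T}, [disjoint U & W] ->
    gamma * #|T|%:R <= #|U|%:R -> gamma * #|T|%:R <= #|W|%:R ->
    `|density R U W - p| <= gamma * p.

(* The path with vertices x :: s in this order; its length is size s. *)
Definition is_path (x : T) (s : seq T) : bool := path G x s && uniq (x :: s).

End Graph.

Definition path_edges (T : finType) (x : T) (s : seq T) : seq {set T} :=
  [seq [set e.1; e.2] | e <- zip (x :: s) s].

(* Main.v *)
Require Import Defs.
From HB Require Import structures.
From mathcomp Require Import all_boot all_order all_algebra.
From mathcomp Require Import boolp reals.
From mathcomp Require Import zify ring lra.

Set Implicit Arguments.
Unset Strict Implicit.
Unset Printing Implicit Defensive.

Import Order.TTheory GRing.Theory Num.Theory.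

(* The proof avoids the sparse regularity lemma. Fix a colour. A pair of equal
   sets [A], [B] is good if any two large subsets of [A] and [B] are joined by
   an edge of the colour; depth-first search then finds a long monochromatic
   path in it, even after [A] and [B] have been thinned to a constant
   proportion, and by density increment every pair of linear sets with many
   edges of the colour contains a good pair of linear size. Consider an optimal
   fractional packing of good pairs in which every pair has weight [1/N]. It
   can be turned into disjoint paths by giving each pair covering a vertex its
   share of the atom of that vertex, and the paths are glued with a bounded
   number of arbitrary edges. Optimality gives the dual object: a fractional
   vertex cover, up to sparse pairs, of weight at most half the length of the
   path. Round the cover of every colour to a half-integral one. As almost all
   pairs of vertices are joined in some colour, the roundings at any two typical
   vertices meet, whence some colour has a cover of weight at least about
   [n / (r + 1)], so a path of length about [2 n / (r + 1)]. *)

(** * Averaging over subsets *)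

Lemma leq_average_subset (T : finType) (f : T -> nat) (A : {set T}) (k : nat) :
  k <= #|A| ->
  exists2 S : {set T}, S \subset A /\ #|S| = k
    & k * \sum_(x in A) f x <= #|A| * \sum_(x in S) f x.
Proof.
move Em : (#|A| - k) => m; elim: m A Em => [|m IHm] A Em lekA.
  by exists A; [split=> //; lia | have -> : k = #|A| by lia].
have /card_gt0P[v0 v0A] : 0 < #|A| by lia.
(* Discarding an element of minimal value does not lower the average. *)
have [v vA minv] := arg_minnP f v0A.
have {}vA : v \in A by [].
have cardA := cardsD1 v A; rewrite vA in cardA.
have [||S [SA Sk] leS] := IHm (A :\ v); [lia|lia|].
exists S; first by split=> //; apply: subset_trans SA (subD1set _ _).
have sumA : \sum_(x in A) f x = f v + \sum_(x in A :\ v) f x by rewrite (big_setD1 v).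
have : #|A| * f v <= \sum_(x in A) f x.
  by rewrite -sum_nat_const; apply: leq_sum => x; exact: minv.
move: leS; rewrite {}sumA; move: (\sum_(x in A :\ v) f x) (\sum_(x in S) f x) => a b.
have {}cardA : #|A| = #|A :\ v|.+1 by lia.
have lekc : k <= #|A :\ v| by lia.
rewrite {}cardA; move: #|A :\ v| (f v) lekc => c d lekc leS led.
have [c0|c_gt0] := posnP c; first by have -> : k = 0 by lia.
rewrite -(leq_pmul2l c_gt0).
apply: (@leq_trans (k * (c.+1 * a))); first by nia.
have -> : c * (c.+1 * b) = c.+1 * (c * b) by lia.
have -> : k * (c.+1 * a) = c.+1 * (k * a) by lia.
by rewrite leq_pmul2l.
Qed.

Lemma subset_of_card (T : finType) (A : {set T}) (k : nat) :
  k <= #|A| -> exists2 S : {set T}, S \subset A & #|S| = k.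
Proof. by case/(leq_average_subset (fun=> 0)) => S [SA Sk] _; exists S. Qed.

(** * Edge counts and the density increment *)

Definition nb_edges (T : finType) (h : rel T) (U W : {set T}) : nat :=
  \sum_(u in U) \sum_(w in W) h u w.

Section NbEdges.
Variables (T : finType) (h : rel T).
Implicit Types U W X Y : {set T}.

Lemma nb_edgesC U W :
  nb_edges h U W = \sum_(w in W) \sum_(u in U) h u w.
Proof. exact: exchange_big. Qed.

Lemma nb_edgesIDl X U W : X \subset U ->
  nb_edges h U W = nb_edges h X W + nb_edges h (U :\: X) W.
Proof.
by move=> XU; rewrite /nb_edges (big_setID X) (setIidPr XU).
Qed.

Lemma nb_edgesIDr Y U W : Y \subset W ->
  nb_edges h U W = nb_edges h U Y + nb_edges h U (W :\: Y).
Proof.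
by move=> YW; rewrite !nb_edgesC (big_setID Y) (setIidPr YW).
Qed.

(** Averaging first over [U] and then over [W] keeps the density from dropping. *)
Lemma leq_density_subsets U W (k l : nat) : k <= #|U| -> l <= #|W| ->
  exists U' W' : {set T}, [/\ U' \subset U, W' \subset W, #|U'| = k, #|W'| = l
    & k * l * nb_edges h U W <= #|U| * #|W| * nb_edges h U' W'].
Proof.
move=> kU lW.
have [U' [U'U U'k] leU] := leq_average_subset (fun u => \sum_(w in W) h u w) kU.
have [W' [W'W W'l] leW] := leq_average_subset (fun w => \sum_(u in U') h u w) lW.
exists U', W'; split=> //.
rewrite -nb_edgesC -[\sum_(w in W') _]nb_edgesC in leW.
rewrite -/(nb_edges h U W) -/(nb_edges h U' W) in leU.
by move: leU leW; nia.
Qed.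

(* Because of the truncated division, no pair with [#|A| < q] is good. *)
Definition good_pair (q : nat) (A B : {set T}) : Prop :=
  #|A| = #|B| /\
  forall X Y : {set T}, X \subset A -> Y \subset B ->
    #|X| = #|A| %/ q -> #|Y| = #|A| %/ q ->
    exists x y, [/\ x \in X, y \in Y & h x y].

End NbEdges.

Section GoodPair.
Variables (T : finType) (h : rel T) (q : nat).
Hypothesis q_gt1 : 1 < q.
Implicit Types A B U W X Y : {set T}.

(** If [X], [Y] of size [k] witness that the pair is not good, all edges lie in the other three
    rectangles, of total area [m ^ 2 - k ^ 2] with [m = #|A|]. One of these is denser than the pair
    by a factor at least [1 + k ^ 2 / m ^ 2], hence at least [1 + 1 / (4 q ^ 2)], and averaging
    shrinks it to [k] by [k]. *)
Lemma good_pair_or_denser A B : #|A| = #|B| -> q <= #|A| ->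
  good_pair h q A B \/
  exists A' B' : {set T},
    [/\ A' \subset A, B' \subset B, #|A'| = #|A| %/ q, #|B'| = #|A| %/ q
      & (4 * q ^ 2 + 1) * (#|A| %/ q) ^ 2 * nb_edges h A B
        <= 4 * q ^ 2 * #|A| ^ 2 * nb_edges h A' B'].
Proof.
move=> AB qA; apply: contrapT => /not_orP[not_good no_denser]; apply: not_good.
split=> // X Y XA YB Xk Yk; apply: contrapT => noXY.
set E := nb_edges h A B in no_denser; set m := #|A| in AB qA no_denser Xk Yk.
set k := m %/ q in no_denser Xk Yk.
have XY0 : nb_edges h X Y = 0.
  apply: big1 => x xX; apply: big1 => y yY; case hxy: (h x y) => //.
  by case: noXY; exists x, y.
have k_gt0 : 0 < k by rewrite divn_gt0 //; lia.
(* Leaves [A :\: X] and [B :\: Y] at least [k] elements, so that all three rectangles can be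
   shrunk. *)
have k2 : 2 * k <= m.
  by apply: leq_trans (leq_mul q_gt1 (leqnn k)) _; rewrite mulnC leq_trunc_div.
have mk : m <= 2 * q * k.
  have : m < k.+1 * q by rewrite ltn_ceil //; lia.
  by nia.
have sparse U W : U \subset A -> W \subset B -> k <= #|U| -> k <= #|W| ->
    4 * q ^ 2 * m ^ 2 * nb_edges h U W <= #|U| * #|W| * ((4 * q ^ 2 + 1) * E)
    /\ 0 < E.
  move=> UA WB kU kW.
  have [U' [W' [U'U W'W U'k W'k le']]] := leq_density_subsets h kU kW.
  have lt' : 4 * q ^ 2 * m ^ 2 * nb_edges h U' W' < (4 * q ^ 2 + 1) * k ^ 2 * E.
    rewrite ltnNge; apply/negP => ge'; apply: no_denser; exists U', W'.
    by split=> //; [exact: subset_trans UA|exact: subset_trans WB].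
  split; last by case: (E) lt' => //; rewrite muln0.
  have kk_gt0 : 0 < k * k by rewrite muln_gt0 k_gt0.
  rewrite -(leq_pmul2l kk_gt0).
  apply: (@leq_trans (4 * q ^ 2 * m ^ 2 * (#|U| * #|W| * nb_edges h U' W'))).
    by rewrite mulnCA leq_mul2l le' orbT.
  apply: (@leq_trans (#|U| * #|W| * ((4 * q ^ 2 + 1) * k ^ 2 * E))); last by lia.
  by rewrite mulnCA leq_mul2l (ltnW lt') orbT.
have cardAX : #|A :\: X| = m - k by rewrite cardsD (setIidPr XA) Xk.
have cardBY : #|B :\: Y| = m - k by rewrite cardsD (setIidPr YB) Yk AB.
have AXA := subsetDl A X; have BYB := subsetDl B Y.
have [||s1 E_gt0] := sparse X (B :\: Y) XA BYB; [lia|lia|].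
have [||s2 _] := sparse (A :\: X) Y AXA YB; [lia|lia|].
have [||s3 _] := sparse (A :\: X) (B :\: Y) AXA BYB; [lia|lia|].
have EE : E = nb_edges h X (B :\: Y) + (nb_edges h (A :\: X) Y + nb_edges h (A :\: X) (B :\: Y)).
  by rewrite /E (nb_edgesIDl _ _ XA) !(nb_edgesIDr _ _ YB) XY0.
have : 4 * q ^ 2 * m ^ 2 * E <= (m ^ 2 - k ^ 2) * ((4 * q ^ 2 + 1) * E).
  rewrite {1}EE 2!mulnDr.
  apply: leq_trans (leq_add s1 (leq_add s2 s3)) _.
  rewrite -!mulnDl leq_mul2r; apply/orP; right.
  rewrite cardAX cardBY Xk Yk.
  have [d ->] : exists d, m = k + d by exists (m - k); lia.
  by rewrite addKn; nia.
rewrite mulnA leq_pmul2r // => bad.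
have mkk : m ^ 2 <= 4 * q ^ 2 * k ^ 2.
  by rewrite -[4]/(2 ^ 2) -!expnMn leq_sqr.
have kk_gt0 : 0 < k ^ 2 by rewrite expn_gt0 k_gt0.
have km : k ^ 2 <= m ^ 2 by rewrite leq_sqr leq_div.
have [d md] : exists d, m ^ 2 = k ^ 2 + d by exists (m ^ 2 - k ^ 2); rewrite subnKC.
move: bad mkk kk_gt0; rewrite md addKn; move: (q ^ 2) (k ^ 2) => a b.
by clear; lia.
Qed.

Local Open Scope ring_scope.

(** Each increment multiplies the density by at least [1 + 1 / (4 q ^ 2)] and divides the size by at
    most [2 q]. After [t] of them the density would reach the forbidden [2 p], so a good pair turns
    up before. *)
Lemma good_pair_in_dense (R : realType) (p : R) (m0 t : nat) A B :
  #|A| = #|B| -> (m0 * (2 * q) ^ t <= #|A|)%N -> (0 < m0)%N ->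
  (forall U W, U \subset A -> W \subset B -> (m0 <= #|U|)%N -> (m0 <= #|W|)%N ->
    (nb_edges h U W)%:R < 2 * p * #|U|%:R * #|W|%:R) ->
  2 * p * #|A|%:R * #|A|%:R <=
    (nb_edges h A B)%:R * (1 + (4 * q%:R ^+ 2)^-1) ^+ t ->
  exists A' B' : {set T}, [/\ A' \subset A, B' \subset B, (m0 <= #|A'|)%N &
    good_pair h q A' B'].
Proof.
elim: t A B => [|t IHt] A B AB lemA m0_gt0 upper.
  rewrite expr0 mulr1 => lower.
  rewrite expn0 muln1 in lemA.
  have lemB : (m0 <= #|B|)%N by rewrite -AB.
  by have := upper A B (subxx _) (subxx _) lemA lemB; rewrite -AB; lra.
move=> lower.
have q_gt0 : (0 < q)%N by lia.
have lemA' : (m0 * (2 * q) ^ t * (2 * q) <= #|A|)%N by rewrite -mulnA -expnSr.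
have pow_gt0 : (0 < (2 * q) ^ t)%N by rewrite expn_gt0 muln_gt0 q_gt0.
have x_gt0 : (m0 <= m0 * (2 * q) ^ t)%N by rewrite leq_pmulr.
move: (m0 * (2 * q) ^ t)%N x_gt0 lemA' (IHt) => x x_gt0 lemA' {}IHt.
have qA : (q <= #|A|)%N by nia.
have [|[A' [B' [A'A B'B A'k B'k dens]]]] := good_pair_or_denser AB qA.
  by exists A, B; split=> //; nia.
have mk : (#|A| < (#|A| %/ q).+1 * q)%N by rewrite ltn_ceil.
have lek : (x <= #|A| %/ q)%N.
  by rewrite leq_divRL //; nia.
case: (IHt A' B').
- by rewrite A'k B'k.
- by rewrite A'k.
- by [].
- by move=> U W UA' WB'; apply: upper; [exact: subset_trans A'A|exact: subset_trans B'B].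
- have A_gt0 : (0 < #|A|)%N by nia.
  rewrite A'k; move: lower dens; set k := (#|A| %/ q)%N.
  set e := nb_edges h A B; set e' := nb_edges h A' B'; set m := #|A| in A_gt0 *.
  move=> lower densN.
  have dens : (4 * q%:R ^+ 2 + 1) * k%:R ^+ 2 * e%:R
      <= 4 * q%:R ^+ 2 * m%:R ^+ 2 * e'%:R :> R.
    by rewrite -[1]/(1%:R) -!natrX -!natrM -natrD -!natrM ler_nat.
  have pos : 0 < (1 + (4 * q%:R ^+ 2)^-1 : R) ^+ t.
    by apply: exprn_gt0; rewrite addr_gt0 // invr_gt0 mulr_gt0 // exprn_gt0 // ltr0n.
  have mR : 0 < (m%:R : R) ^+ 2 by rewrite exprn_gt0 // ltr0n.
  have qR : 0 < (q%:R : R) ^+ 2 by rewrite exprn_gt0 // ltr0n.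
  have dens' : (1 + (4 * q%:R ^+ 2)^-1) * k%:R ^+ 2 * e%:R <= m%:R ^+ 2 * e'%:R :> R.
    have : 0 < 4 * q%:R ^+ 2 :> R by rewrite mulr_gt0.
    move: dens; move: (4 * q%:R ^+ 2) => z; rewrite !mulrA => dens z_gt0.
    by rewrite -(ler_pM2l z_gt0) !mulrA (mulrDr z) mulr1 divff ?gt_eqF.
  rewrite -(ler_pM2l mR).
  move: lower dens' pos; rewrite exprS.
  move: (1 + _) => a; move: (a ^+ t) => b lower dens' b_gt0.
  have kR : 0 <= (k%:R : R) ^+ 2 by rewrite exprn_ge0.
  have := ler_wpM2l kR lower; have := ler_wpM2r (ltW b_gt0) dens'.
  by rewrite !expr2; lra.
- move=> A'' [B'' [A''A' B''B' m0A'' gAB]].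
  exists A'', B''; split=> //; [exact: subset_trans A'A|exact: subset_trans B'B].
Qed.

End GoodPair.

(** * Long paths in good pairs *)

Section DepthFirst.
Variables (T : finType) (h : rel T) (V : {set T}).
Hypothesis h_sym : symmetric h.

(* A snapshot of depth-first search: [s] is the stack, top first, [S] the
   explored vertices; [2 |S| + |s|] grows by one at each step. *)
Lemma depth_first_search (t : nat) : t <= 2 * #|V| ->
  exists (S : {set T}) (s : seq T),
    [/\ S \subset V, {subset s <= V :\: S}, uniq s && sorted h s, 2 * #|S| + size s = t
      & forall x y, x \in S -> y \in V :\: S -> y \notin s -> ~~ h x y].
Proof.
elim: t => [_|t IHt lt_t].
  by exists set0, [::]; split; rewrite ?sub0set ?cards0 // => x y; rewrite inE.
have [S [s [SV sV /andP[s_uniq s_sorted] size_s noSU]]] := IHt (ltnW lt_t).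
have leSV := subset_leq_card SV.
have pushable u : u \in V :\: S -> u \notin s -> sorted h (u :: s) ->
    exists (S : {set T}) (s : seq T),
    [/\ S \subset V, {subset s <= V :\: S}, uniq s && sorted h s, 2 * #|S| + size s = t.+1
      & forall x y, x \in S -> y \in V :\: S -> y \notin s -> ~~ h x y].
  move=> uVS us us_sorted; exists S, (u :: s); split=> //.
  - by move=> x; rewrite inE => /predU1P[->|/sV].
  - by rewrite us_sorted andbT /= us.
  - by rewrite /=; lia.
  - by move=> x y xS yVS; rewrite inE negb_or => /andP[_]; apply: noSU.
case: s => [|x s] in sV s_uniq s_sorted size_s noSU pushable *.
  have /card_gt0P[u uVS] : 0 < #|V :\: S|.
    by rewrite cardsD (setIidPr SV); move: size_s => /=; lia.
  exact: pushable uVS _ _.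
have [[u [uVS us hxu]]|no_u] := pselect (exists u, [/\ u \in V :\: S, u \notin x :: s & h x u]).
  by apply: pushable uVS us _; rewrite /= h_sym hxu.
have xVS : x \in V :\: S by apply: sV; rewrite mem_head.
have [xV xS] : x \in V /\ x \notin S by move: xVS; rewrite inE => /andP[].
move: s_uniq => /= /andP[xs s_uniq].
(* The top of the stack has no fresh neighbour left and becomes explored. *)
exists (x |: S), s; split=> //.
- by rewrite subUset sub1set xV.
- move=> y ys; have := sV y; rewrite !inE ys orbT => /(_ isT) /andP[yS ->].
  by rewrite (negPf yS) orbF andbT; apply: contraNneq xs => <-.
- by rewrite s_uniq; apply: path_sorted s_sorted.
- by rewrite cardsU1 xS; move: size_s => /=; lia.
- move=> y z yxS; rewrite !inE negb_or => /andP[/andP[zx zS] zV] zs.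
  have zVS : z \in V :\: S by rewrite inE zS.
  have zxs : z \notin x :: s by rewrite inE negb_or zx.
  move: yxS; rewrite !inE => /predU1P[->|yS]; last exact: noSU.
  by apply/negP => hxz; apply: no_u; exists z.
Qed.

End DepthFirst.

Lemma count_alternating (T : eqType) (P : pred T) (h : rel T) (s : seq T) :
  (forall x y, h x y -> P y = ~~ P x) -> sorted h s ->
  count P s <= (count (predC P) s).+1 /\ count (predC P) s <= (count P s).+1.
Proof.
move=> hP; case: s => //= x s.
(* Sharper form for the induction: only the class of the first vertex can be ahead. *)
have : path h x s ->
    P x + count P s <= ~~ P x + count (predC P) s + P x /\
    ~~ P x + count (predC P) s <= P x + count P s + ~~ P x.
  elim: s x => [|y s IHs] x /=; first by case: (P x).
  by case/andP => /hP Py /IHs; rewrite Py; case: (P x) => /=; lia.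
by move=> le /le; case: (P x) => /=; lia.
Qed.

(** Stopped at [t = #|A :|: B|], the search leaves as many explored vertices [S] as untouched ones
    [U]. Since the stack alternates between [A] and [B], this forces [S :&: A] and [U :&: B] to be
    equally large, and likewise [S :&: B] and [U :&: A]. No edge joins the two sets of either
    couple, so all four have fewer than [k] vertices. *)
Lemma long_path_of_bipartite (T : finType) (h : rel T) (A B : {set T}) (k : nat) :
  symmetric h -> [disjoint A & B] -> #|A| = #|B| ->
  (forall X Y : {set T}, X \subset A -> Y \subset B -> #|X| = k -> #|Y| = k ->
    exists x y, [/\ x \in X, y \in Y & h x y]) ->
  exists s : seq T, [/\ {subset s <= A :|: B}, uniq s, sorted h s
    & 2 * #|A| <= size s + 4 * k + 1].
Proof.
move=> h_sym AB eqAB joined.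
(* Edges inside [A] or inside [B] are dropped, so that the path alternates. *)
pose b x y := h x y && ((x \in A) && (y \in B) || (x \in B) && (y \in A)).
have b_sym : symmetric b.
  by move=> x y; rewrite /b h_sym orbC [(x \in B) && _]andbC [(x \in A) && _]andbC.
have notAB x : x \in A -> x \in B = false by move=> xA; apply/negbTE; rewrite (disjointFr AB).
have [|S [s [SV sV /andP[s_uniq s_sorted] size_s noSU]]] :=
  @depth_first_search T b (A :|: B) b_sym #|A :|: B|; first by lia.
have cardAB : #|A :|: B| = #|A| + #|B|.
  by rewrite cardsU (disjoint_setI0 AB) cards0 subn0.
pose U := (A :|: B) :\: S :\: [set x in s].
have no_big_hole C D : C = A /\ D = B \/ C = B /\ D = A ->
    #|S :&: C| < k \/ #|U :&: D| < k.
  move=> CD; have [|kS] := ltnP; [by left|right].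
  rewrite ltnNge; apply/negP => kU.
  have [X /subsetIP[XS XC] Xk] := subset_of_card kS.
  have [Y /subsetIP[YU YD] Yk] := subset_of_card kU.
  have noXY x y : x \in X -> y \in Y -> ~~ b x y.
    move=> xX yY; apply: noSU; first exact: subsetP xX.
      by have := subsetP YU y yY; rewrite inE => /andP[].
    by have := subsetP YU y yY; rewrite !inE => /andP[].
  case: CD => -[C_eq D_eq]; rewrite {}C_eq {}D_eq in XC YD.
    have [x [y [xX yY hxy]]] := joined X Y XC YD Xk Yk.
    by have := noXY x y xX yY; rewrite /b hxy (subsetP XC _ xX) (subsetP YD _ yY).
  have [y [x [yY xX hyx]]] := joined Y X YD XC Yk Xk.
  by have := noXY x y xX yY; rewrite b_sym /b hyx (subsetP XC _ xX) (subsetP YD _ yY).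
have sb : sorted h s by apply: sub_sorted s_sorted => x y /andP[].
exists s; split=> //; first by move=> x /sV; rewrite inE => /andP[].
have [le1 le2] : count (mem A) s <= (count (predC (mem A)) s).+1 /\
    count (predC (mem A)) s <= (count (mem A) s).+1.
  apply: count_alternating s_sorted => x y /andP[_ /orP[]/andP[]] /=.
    by move=> -> yB; rewrite (disjointFl AB).
  by move=> xB ->; rewrite (disjointFl AB).
pose s' := [set x in s].
have size_count (C : {set T}) : #|s' :&: C| = count (mem C) s.
  rewrite -size_filter -(card_uniqP (filter_uniq _ s_uniq)).
  by apply: eq_card => x; rewrite !inE mem_filter andbC.
have sA := size_count A.
have sB : #|s' :&: B| = count (predC (mem A)) s.
  rewrite size_count; apply: eq_in_count => x /sV; rewrite !inE => /andP[_].
  change ((x \in A) || (x \in B) -> (x \in B) = (x \notin A)).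
  case: (boolP (x \in A)) => xA; first by rewrite (notAB _ xA).
  by move=> /= ->.
have split3 (C : {set T}) : C \subset A :|: B -> #|C| = #|S :&: C| + #|s' :&: C| + #|U :&: C|.
  move=> CAB; rewrite -(cardsID S C) setIC -addnA; congr (_ + _).
  rewrite -(cardsID s' (C :\: S)); congr (_ + _).
    apply: eq_card => x; rewrite !inE andbC.
    case xs: (x \in s) => //=; have := sV x xs; rewrite inE => /andP[-> _] //.
  apply: eq_card => x; rewrite !inE.
  case xC: (x \in C); rewrite ?andbF //.
  have xAB : (x \in A) || (x \in B) by have := subsetP CAB x xC; rewrite inE.
  by rewrite xAB !andbT.
have cA := split3 A (subsetUl A B); have cB := split3 B (subsetUr A B).
have hAB := no_big_hole A B (or_introl (conj erefl erefl)).
have hBA := no_big_hole B A (or_intror (conj erefl erefl)).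
have sizes : size s = count (mem A) s + count (predC (mem A)) s by rewrite count_predC.
have cardS : #|S| = #|S :&: A| + #|S :&: B|.
  rewrite -(cardsID A S); congr (_ + _); apply: eq_card => x; rewrite !inE.
  case xS: (x \in S); rewrite ?andbF //= andbT.
  have := subsetP SV x xS; rewrite inE; case: (boolP (x \in A)) => [xA|xA /= ->] //.
  by rewrite notAB.
by clear -sizes cardS hAB hBA cA cB sA sB le1 le2 size_s eqAB cardAB; lia.
Qed.

(** * Fractional packings *)

Lemma exists_minimizer (A : Type) (P : A -> Prop) (f : A -> nat) (a0 : A) :
  P a0 -> exists2 a, P a & forall b, P b -> f a <= f b.
Proof.
move=> Pa0; have ex : exists n, `[< exists2 a, P a & f a = n >].
  by exists (f a0); apply/asboolP; exists a0.
case: (ex_minnP ex) => n /asboolP[a Pa <-] fmin.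
by exists a => // b Pb; apply: fmin; apply/asboolP; exists b.
Qed.

Section Packing.
Variables (T : finType) (P : {set T} -> Prop) (N D : nat).
Implicit Types (s : seq {set T}) (Q : {set T}).

Definition load s (v : T) : nat := count (fun Q => v \in Q) s.
Definition excess s (v : T) : nat := load s v - N.

(* Up to an additive constant, [2 D c - (c - N)^2], where the subtraction is
   truncated, is the reward for covering a vertex [c] times. *)
Let penalty (c : nat) : nat := 2 * D * N + D ^ 2 + (c - N) ^ 2 - 2 * D * c.

(** Makes the truncated subtraction in [penalty] exact: [2 D d <= D ^ 2 + d ^ 2] for the excess
    [d]. *)
Lemma penalty_ge0 c : 2 * D * c <= 2 * D * N + D ^ 2 + (c - N) ^ 2.
Proof.
have [cN|Nc] := leqP c N; first by nia.
have [d ->] : exists d, c = N + d by exists (c - N); lia.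
by rewrite addKn; have [] := nat_Cauchy D d; lia.
Qed.

Lemma penaltyS c : penalty c.+1 + 2 * D <= penalty c + (2 * (c - N) + 1).
Proof.
have := penalty_ge0 c; have := penalty_ge0 c.+1; rewrite /penalty.
have [cN|Nc] := leqP c.+1 N.
  have -> : c.+1 - N = 0 by lia.
  have -> : c - N = 0 by lia.
  by lia.
have [d ->] : exists d, c = N + d by exists (c - N); lia.
rewrite addKn -addnS addKn; nia.
Qed.

Lemma penalty_pred c : penalty c + (2 * (c.+1 - N) - 1) <= penalty c.+1 + 2 * D.
Proof.
have := penalty_ge0 c; have := penalty_ge0 c.+1; rewrite /penalty.
have [cN|Nc] := leqP c.+1 N.
  have -> : c.+1 - N = 0 by lia.
  have -> : c - N = 0 by lia.
  by lia.
have [d ->] : exists d, c = N + d by exists (c - N); lia.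
rewrite addKn -addnS addKn; nia.
Qed.

Lemma sum_load s : \sum_v load s v = \sum_(Q <- s) #|Q|.
Proof.
under eq_bigr do rewrite /load -sum1_count big_mkcond.
rewrite exchange_big; apply: eq_bigr => Q _.
by rewrite -sum1_card [RHS]big_mkcond.
Qed.

Lemma sum_load_mul s (f : T -> nat) :
  \sum_v load s v * f v = \sum_(Q <- s) \sum_(v in Q) f v.
Proof.
under eq_bigr do rewrite /load -sum1_count big_mkcond big_distrl.
rewrite exchange_big; apply: eq_bigr => Q _.
rewrite [RHS]big_mkcond; apply: eq_bigr => v _.
by rewrite /=; case: (v \in Q); rewrite ?mul1n ?mul0n.
Qed.

(* The family minimizes the total penalty; the first bound says that adding a
   set does not pay, the second one that removing a set does not. *)
Lemma exists_optimal_packing :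
  exists s, [/\ forall Q, Q \in s -> P Q,
    forall Q, P Q -> 2 * D * #|Q| <= \sum_(v in Q) (2 * excess s v + 1)
    & N * \sum_v (2 * excess s v - 1) <= 2 * D * \sum_v load s v].
Proof.
have nilP Q : Q \in [::] -> P Q by [].
have [s sP smin] := @exists_minimizer _ (fun s => forall Q, Q \in s -> P Q)
    (fun s => \sum_v penalty (load s v)) [::] nilP.
exists s; split=> // [Q PQ|].
  have QsP Q' : Q' \in Q :: s -> P Q' by rewrite inE => /predU1P[->|/sP].
  have := smin _ QsP; rewrite -(leq_add2r (2 * D * #|Q|)) => le1.
  have le2 : \sum_v penalty (load (Q :: s) v) + 2 * D * #|Q| <=
      \sum_v penalty (load s v) + \sum_(v in Q) (2 * excess s v + 1).
    rewrite (eq_bigr (fun v => penalty ((v \in Q) + load s v))) //.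
    rewrite mulnC -sum_nat_const (big_mkcond (mem Q)) [X in _ <= _ + X](big_mkcond (mem Q)).
    rewrite -!big_split; apply: leq_sum => v _ /=.
    by case: (v \in Q); rewrite ?add0n ?add1n ?penaltyS.
  by lia.
have removal Q : Q \in s -> \sum_(v in Q) (2 * excess s v - 1) <= 2 * D * #|Q|.
  move=> Qs.
  have /smin : forall Q', Q' \in rem Q s -> P Q' by move=> Q' /mem_rem/sP.
  rewrite -(leq_add2r (2 * D * #|Q|)) => le1.
  have le2 : \sum_v penalty (load (rem Q s) v) + \sum_(v in Q) (2 * excess s v - 1) <=
      \sum_v penalty (load s v) + 2 * D * #|Q|.
    rewrite mulnC -sum_nat_const (big_mkcond (mem Q)) [X in _ <= _ + X](big_mkcond (mem Q)).
    rewrite -!big_split; apply: leq_sum => v _ /=.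
    have loadE : load s v = (v \in Q) + load (rem Q s) v.
      by have /permP/(_ (fun Q => v \in Q)) := perm_to_rem Qs.
    rewrite /excess loadE; case: (v \in Q) => //.
    by rewrite add1n penalty_pred.
  by lia.
(* Only vertices of load above [N] have nonzero excess, so weighting by the load gains the factor
   [N]; double counting then reduces to [removal]. *)
apply: (@leq_trans (\sum_v load s v * (2 * excess s v - 1))).
  rewrite big_distrr; apply: leq_sum => v _ /=.
  have [vN|Nv] := leqP (load s v) N; last by rewrite leq_mul2r ltnW ?orbT.
  have -> : excess s v = 0 by rewrite /excess; lia.
  by rewrite !muln0.
rewrite sum_load_mul sum_load big_distrr big_seq [leqRHS]big_seq.
by apply: leq_sum => Q; apply: removal.
Qed.

End Packing.

(** * From fractional to disjoint packings *)

(** Number the elements of [E] and reduce modulo [N]: every residue class has at least [#|E| %/ N]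
    elements. *)
Lemma equipartition (T : finType) (N : nat) (E : {set T}) : 0 < N ->
  exists rho : T -> nat, forall q, q < N ->
    #|E| <= N * #|[set v in E | rho v == q]| + N.
Proof.
move=> N_gt0; exists (fun v => index v (enum E) %% N) => q qN.
have [->|[x0 _]] := set_0Vmem E; first by rewrite cards0.
pose pos (k : 'I_(#|E| %/ N)) := k * N + q.
have pos_lt k : pos k < size (enum E).
  rewrite -cardE; apply: leq_trans (leq_trunc_div #|E| N).
  by rewrite /pos; case: k => k /= kN; nia.
pose F k := nth x0 (enum E) (pos k).
have F_inj : injective F.
  move=> k l /eqP; rewrite nth_uniq ?enum_uniq // eqn_add2r eqn_pmul2r //.
  by move=> /eqP/val_inj.
have : #|E| %/ N <= #|[set v in E | index v (enum E) %% N == q]|.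
  rewrite -{1}(card_ord (#|E| %/ N)) -cardsT -(card_imset _ F_inj).
  apply/subset_leq_card/subsetP => _ /imsetP[k _ ->].
  rewrite inE -mem_enum mem_nth //= index_uniq ?enum_uniq //.
  by rewrite modnMDl modn_small.
by have := ltn_ceil #|E| N_gt0; nia.
Qed.

Lemma equipartition_fibers (T F : finType) (f : T -> F) (N : nat) : 0 < N ->
  exists rho : T -> nat, forall x q, q < N ->
    #|[set v | f v == x]| <= N * #|[set v | (f v == x) && (rho v == q)]| + N.
Proof.
move=> N_gt0.
have [rho rhoP] := fin_all_exists (fun x => equipartition [set v | f v == x] N_gt0).
exists (fun v => rho (f v) v) => x q /(rhoP x) le.
suff -> : [set v | (f v == x) && (rho (f v) v == q)]
    = [set v in [set v | f v == x] | rho x v == q] by [].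
by apply/setP => v; rewrite !inE; case: eqP => // ->.
Qed.

Lemma card_fibers (T F : finType) (f : T -> F) (S : {set T}) :
  #|S| = \sum_x #|[set v in S | f v == x]|.
Proof.
rewrite -sum1_card (partition_big f predT) //=; apply: eq_bigr => x _.
by rewrite -sum1_card; apply: eq_bigl => v; rewrite inE.
Qed.

Section DisjointShares.
Variables (T : finType) (J N : nat) (A B Q : 'I_J -> {set T}).
Hypotheses (N_gt0 : 0 < N) (AQ : forall j, A j \subset Q j) (BQ : forall j, B j \subset Q j).

Let rank (j : 'I_J) (v : T) : nat := #|[set i : 'I_J | (i < j) && (v \in Q i)]|.
Let lost (j : 'I_J) : nat := #|[set v in Q j | N <= rank j v]|.

Let rank_lt (i j : 'I_J) v : v \in Q i -> i < j -> rank i v < rank j v.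
Proof.
move=> vQi ij; apply: proper_card; apply/properP; split.
  apply/subsetP => k; rewrite !inE => /andP[ki ->].
  by rewrite (ltn_trans ki ij).
by exists i; rewrite inE ?ij ?vQi ?ltnn.
Qed.

Let rank_inj (i j : 'I_J) v : v \in Q i -> v \in Q j -> rank i v = rank j v -> i = j.
Proof.
move=> vQi vQj rij; apply/val_inj => /=.
by case: (ltngtP i j) => // /rank_lt; [move/(_ v vQi)|move/(_ v vQj)]; rewrite rij ltnn.
Qed.

(** The pairs that lose [v] have distinct ranks at [v], all at least [N] and below the number of
    pairs covering [v]. *)
Let sum_lost : \sum_j lost j <= \sum_v (#|[set j | v \in Q j]| - N).
Proof.
have -> : \sum_j lost j = \sum_v #|[set j | (v \in Q j) && (N <= rank j v)]|.
  under eq_bigr do rewrite /lost -sum1_card big_mkcond.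
  rewrite exchange_big; apply: eq_bigr => v _.
  rewrite -sum1_card [RHS]big_mkcond; apply: eq_bigr => j _.
  by rewrite !inE.
apply: leq_sum => v _; set c := #|_| - N.
rewrite cardE -(size_map (rank^~ v)) -(size_iota N c).
apply: uniq_leq_size.
  rewrite map_inj_in_uniq ?enum_uniq // => i j.
  rewrite !mem_enum !inE => /andP[vQi _] /andP[vQj _]. exact: rank_inj.
move=> _ /mapP[j + ->]; rewrite mem_enum inE mem_iota => /andP[vQj Nj].
rewrite Nj /=; suff : rank j v < #|[set j | v \in Q j]| by rewrite /c; lia.
apply: proper_card; apply/properP; split.
  by apply/subsetP => k; rewrite !inE => /andP[].
by exists j; rewrite inE ?vQj ?ltnn.
Qed.

(* Each atom of the algebra generated by the sets [A j] and [B j] is divided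
   into [N] almost equal parts, and the [k]-th of the pairs covering it
   receives the [k]-th part; pairs beyond the [N]-th lose the atom. *)
Lemma disjoint_shares :
  exists (A' B' : 'I_J -> {set T}) (l : 'I_J -> nat),
  [/\ forall j, A' j \subset A j /\ B' j \subset B j,
      forall i j v, v \in A' i :|: B' i -> v \in A' j :|: B' j -> i = j,
      forall j, #|A j| <= N * #|A' j| + l j + N * 8 ^ J
                /\ #|B j| <= N * #|B' j| + l j + N * 8 ^ J
    & \sum_j l j <= \sum_v (#|[set j | v \in Q j]| - N)].
Proof.
(* [f v] names the atom of [v]. Three bits for each of [J] indices allow at most [8 ^ J] atoms, each
   costing at most [N] by rounding. *)
pose f v := [ffun j => (v \in A j, v \in B j, v \in Q j)].
have [rho rhoP] := equipartition_fibers f N_gt0.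
pose share (C : 'I_J -> {set T}) j := [set v in C j | rho v == rank j v].
exists (share A), (share B), lost; split=> //.
- by move=> j; split; apply/subsetP => v; rewrite inE => /andP[].
- move=> i j v vi vj.
  have unpack k : v \in share A k :|: share B k -> v \in Q k /\ rho v = rank k v.
    rewrite !inE => /orP[] /andP[vk /eqP ->]; split=> //.
      exact: subsetP (AQ k) v vk.
    exact: subsetP (BQ k) v vk.
  have [vQi ri] := unpack i vi; have [vQj rj] := unpack j vj.
  by apply: (@rank_inj i j v) => //; rewrite -ri.
have rankE j v w : f v = f w -> rank j v = rank j w.
  move=> /ffunP fvw; apply: eq_card => i; rewrite !inE.
  by have := fvw i; rewrite !ffunE => -[_ _ ->].
have main (C : 'I_J -> {set T}) j : C j \subset Q j ->
    (forall v w, f v = f w -> v \in C j -> w \in C j) ->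
    #|C j| <= N * #|share C j| + lost j + N * 8 ^ J.
  move=> CQ Cf.
  have -> : 8 ^ J = \sum_(x : {ffun 'I_J -> bool * bool * bool}) 1.
    by rewrite sum1_card card_ffun !card_prod card_bool card_ord.
  rewrite (card_fibers f (C j)) (card_fibers f (share C j)) /lost.
  rewrite (card_fibers f [set v in Q j | _]) !big_distrr -!big_split /=.
  apply: leq_sum => x _; rewrite muln1.
  have [->|[v]] := set_0Vmem [set v in C j | f v == x]; first by rewrite cards0.
  rewrite inE => /andP[vC /eqP fv].
  have fiberC w : f w == x -> w \in C j by move/eqP => fw; apply: Cf vC; rewrite fv.
  (* The rank is constant on an atom, which is thus either lost entirely or shared evenly. *)
  have [Nr|rN] := leqP N (rank j v).
    apply: (@leq_trans #|[set w in [set w in Q j | N <= rank j w] | f w == x]|).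
      apply/subset_leq_card/subsetP => w; rewrite !inE => /andP[wC /eqP fw].
      rewrite (subsetP CQ w wC).
      by rewrite (rankE j w v) ?Nr ?fw ?fv /=.
    by rewrite addnAC leq_addl.
  apply: leq_trans (_ : _ <= #|[set w | f w == x]|) _.
    by apply/subset_leq_card/subsetP => w; rewrite !inE => /andP[].
  apply: leq_trans (rhoP x _ rN) _; rewrite leq_add2r.
  apply: leq_trans (leq_addr _ _); rewrite leq_pmul2l //.
  apply/subset_leq_card/subsetP => w; rewrite !inE => /andP[fw rw].
  by rewrite fw (fiberC w fw) (eqP rw) (rankE j w v) ?eqxx // fv (eqP fw).
have fA j v w : f v = f w -> (v \in A j = (w \in A j)) * (v \in B j = (w \in B j)).
  by move=> /ffunP/(_ j); rewrite !ffunE => -[-> -> _].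
move=> j; split; apply: main.
- exact: AQ.
- by move=> v w /(fA j) [->].
- exact: BQ.
- by move=> v w /(fA j) [_ ->].
Qed.

End DisjointShares.

(** * Gluing paths *)

Section Gluing.
Variables (T : finType) (G h : rel T).
Hypothesis hG : subrel h G.

Definition nb_steps_outside (s : seq T) : nat :=
  count (fun e => ~~ h e.1 e.2) (zip s (behead s)).

Arguments nb_steps_outside : simpl never.

Lemma nb_steps_outside_cat s u w t :
  nb_steps_outside (rcons s u ++ w :: t) =
  nb_steps_outside (rcons s u) + ~~ h u w + nb_steps_outside (w :: t).
Proof.
elim: s => [|x s IHs]; first by [].
have step y z r : nb_steps_outside (y :: z :: r) = ~~ h y z + nb_steps_outside (z :: r) by [].
by move: IHs; case: s => [|y s]; rewrite /= !step; lia.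
Qed.

Lemma nb_steps_outside_sorted s : sorted h s -> nb_steps_outside s = 0.
Proof.
case: s => // x s; elim: s x => // y s IHs x /= /andP[hxy /IHs].
by rewrite /nb_steps_outside /= hxy => ->.
Qed.

(** An edge of [G] joins the last [m] vertices of the path built so far to the first [m] of the next
    one; cutting there loses at most [2 * m] vertices and adds at most one step outside [h]. A path
    with at most [m] vertices is simply dropped. *)
Lemma glue_paths (m : nat) (Ps : seq (seq T)) :
  (forall U W : {set T}, [disjoint U & W] -> #|U| = m -> #|W| = m ->
    exists u w, [/\ u \in U, w \in W & G u w]) ->
  (forall P, P \in Ps -> sorted h P) -> uniq (flatten Ps) ->
  exists s : seq T, [/\ uniq s && sorted G s, {subset s <= flatten Ps},
    nb_steps_outside s <= size Ps
    & size (flatten Ps) <= size s + 2 * m * size Ps].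
Proof.
move=> joined; elim: Ps => [_ _|P Ps IHPs Ps_sorted]; first by exists [::].
rewrite /= cat_uniq => /and3P[P_uniq /hasPn disjP Ps_uniq].
have [|//|s [/andP[s_uniq s_sorted] s_sub s_out s_size]] := IHPs.
  by move=> P' P'Ps; apply: Ps_sorted; rewrite inE P'Ps orbT.
have P_sorted : sorted h P by apply: Ps_sorted; rewrite mem_head.
have [Pm|mP] := leqP (size P) m.
  exists s; split; rewrite ?s_uniq ?s_sorted //.
  - by move=> x /s_sub xs; rewrite mem_cat xs orbT.
  - by rewrite ltnW.
  - by rewrite size_cat; lia.
have [sm|ms] := leqP (size s) m.
  exists P; split.
  - by rewrite P_uniq; apply: sub_sorted P_sorted.
  - by move=> x xP; rewrite mem_cat xP.
  - by rewrite nb_steps_outside_sorted.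
  - by rewrite size_cat; lia.
pose U := [set x in take m P]; pose W := [set x in drop (size s - m) s].
have disjUW : [disjoint U & W].
  rewrite disjoint_subset; apply/subsetP => x; rewrite !inE => /mem_take xP.
  by apply/negP => /mem_drop/s_sub/disjP; rewrite /= xP.
have Um : #|U| = m.
  by rewrite cardsE (card_uniqP (take_uniq _ P_uniq)) size_takel // ltnW.
have Wm : #|W| = m.
  by rewrite cardsE (card_uniqP (drop_uniq _ s_uniq)) size_drop; lia.
rewrite disjoint_sym in disjUW.
have [w [u []]] := joined W U disjUW Wm Um; rewrite !inE => ws uP Gwu.
have [P1 [P2 EP]] : exists P1 P2, take m P = P1 ++ u :: P2.
  by case/splitPr: uP => P1 P2; exists P1, P2.
have [s1 [s2 Es]] : exists s1 s2, drop (size s - m) s = s1 ++ w :: s2.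
  by case/splitPr: ws => s1 s2; exists s1, s2.
have P1m : size P1 < m.
  by have := congr1 size EP; rewrite size_takel ?(ltnW mP) // size_cat /=; clear; lia.
have s2m : size s2 < m.
  by have := congr1 size Es; rewrite size_drop size_cat /=; clear -ms; lia.
have {EP} EP : P = P1 ++ u :: (P2 ++ drop m P).
  by rewrite -{1}(cat_take_drop m P) EP -catA.
have {Es} Es : s = rcons (take (size s - m) s ++ s1) w ++ s2.
  by rewrite -{1}(cat_take_drop (size s - m) s) Es cat_rcons catA.
move: (P2 ++ _) (take _ _ ++ _) EP Es => {}P2 {}s1 EP Es.
have disj x : x \in rcons s1 w -> x \notin u :: P2.
  move=> xs; apply/negP => xP; have /s_sub/disjP/negP : x \in s by rewrite Es mem_cat xs.
  by apply; rewrite /= EP mem_cat xP orbT.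
exists (rcons s1 w ++ u :: P2); split.
- apply/andP; split.
    rewrite cat_uniq; apply/and3P; split.
    + by move: s_uniq; rewrite Es cat_uniq => /and3P[].
    + by apply/hasPn => x xP; apply/negP => /disj; rewrite xP.
    + by move: P_uniq; rewrite EP cat_uniq => /and3P[].
  have s1_sorted : sorted G (rcons s1 w).
    by move: s_sorted; rewrite Es => /cat_sorted2[].
  have P2_sorted : sorted G (u :: P2).
    by move: (sub_sorted hG P_sorted); rewrite EP => /cat_sorted2[].
  move: s1_sorted; case: (s1) => [|x s3] /= => [_|s3_path]; first by rewrite Gwu.
  by rewrite cat_path s3_path last_rcons /= Gwu.
- move=> x; rewrite !mem_cat => /orP[xs|xP].
    by rewrite s_sub ?orbT // Es mem_cat xs.
  by rewrite EP mem_cat xP orbT.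
- rewrite nb_steps_outside_cat.
  have -> : nb_steps_outside (u :: P2) = 0.
    by apply: nb_steps_outside_sorted; move: P_sorted; rewrite EP => /cat_sorted2[].
  have : nb_steps_outside (rcons s1 w) <= nb_steps_outside s.
    rewrite [in leqRHS]Es; case: (s2) => [|y s3]; first by rewrite cats0.
    by rewrite nb_steps_outside_cat -addnA leq_addr.
  by rewrite /=; clear -s_out; lia.
- have sP := congr1 size EP; have ss := congr1 size Es.
  move: sP ss; rewrite !size_cat !size_rcons /= => sP ss.
  by clear -sP ss P1m s2m s_size; lia.
Qed.

End Gluing.

Lemma uniq_flatten_map (I T : eqType) (P : I -> seq T) (s : seq I) :
  uniq s -> (forall i, uniq (P i)) ->
  (forall i j x, x \in P i -> x \in P j -> i = j) -> uniq (flatten (map P s)).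
Proof.
move=> + P_uniq P_disj; elim: s => //= i s IHs /andP[i_s /IHs s_uniq].
rewrite cat_uniq P_uniq s_uniq andbT; apply/hasPn => x /flatten_mapP[j js xj].
by apply: contra i_s => /= xi; rewrite (P_disj i j x).
Qed.

Lemma load_nth (T : finType) (s : seq {set T}) (v : T) :
  load s v = #|[set j : 'I_(size s) | v \in nth set0 s j]|.
Proof.
rewrite /load -sum1_count (big_nth set0) big_mkord -sum1_card.
by apply: eq_bigl => j; rewrite inE.
Qed.

(** * The path and the cover from an optimal packing *)

Section AlmostMonochromaticPath.
Variables (T : finType) (G h : rel T) (D N q m0 m : nat).
Hypotheses (h_sym : symmetric h) (hG : subrel h G).
Hypotheses (D_gt0 : 0 < D) (DN : 4 * D <= N).
Hypothesis joined : forall U W : {set T}, [disjoint U & W] -> #|U| = m -> #|W| = m ->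
  exists u w, [/\ u \in U, w \in W & G u w].

(* [g] is the excess of an optimal packing, so that [g / (2 D)] is a fractional
   cover; [J] is the number of pairs [A_j], [B_j] of the packing and [X] is the
   sum of the [#|A_j| %/ q]. *)
Lemma path_from_packing :
  exists (g : T -> nat) (s : seq T) (J X : nat),
  [/\ uniq s && sorted G s, nb_steps_outside h s <= J,
      J * m0 <= N * #|T| /\ q * X <= N * #|T|,
      2 * N * \sum_v g v <= N * #|T| +
        2 * D * (N * (size s + 2 * m * J) + 8 * D * #|T| + J * N * (2 * 8 ^ J + 1) + 4 * N * X)
    & forall A B : {set T}, [disjoint A & B] -> m0 <= #|A| -> good_pair h q A B ->
      (2 * D - 1) * #|A| <= \sum_(v in A) g v + \sum_(v in B) g v].
Proof.
pose P Q := exists A B : {set T},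
  [/\ Q = A :|: B, [disjoint A & B], m0 <= #|A| & good_pair h q A B].
have [s [sP add_s rem_s]] := exists_optimal_packing P N D.
pose J := size s; pose Q (j : 'I_J) := nth set0 s j.
have /fin_all_exists[A /fin_all_exists[B AB]] j : exists A B : {set T},
    [/\ Q j = A :|: B, [disjoint A & B], m0 <= #|A| & good_pair h q A B].
  by apply: sP; rewrite mem_nth.
have N_gt0 : 0 < N by lia.
have AQ j : A j \subset Q j by have [-> _ _ _] := AB j; apply: subsetUl.
have BQ j : B j \subset Q j by have [-> _ _ _] := AB j; apply: subsetUr.
have [A' [B' [l [sub' disj' card' sum_l]]]] := disjoint_shares N_gt0 AQ BQ.
have cardQ j : #|Q j| = 2 * #|A j|.
  have [-> dAB _ [cAB _]] := AB j.
  by rewrite cardsU (disjoint_setI0 dAB) cards0 subn0 -cAB; lia.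
have path_j j : exists Pj : seq T, [/\ {subset Pj <= A' j :|: B' j},
    uniq Pj, sorted h Pj & #|Q j| <= N * size Pj + 2 * l j
      + N * (2 * 8 ^ J + 1) + 4 * N * (#|A j| %/ q)].
  have [_ dAB _ [cAB joinedAB]] := AB j; have [A'A B'B] := sub' j.
  (* The two shares may differ in size, so both are cut down to the smaller one. *)
  pose k := minn #|A' j| #|B' j|.
  have [A2 A2A' A2k] := subset_of_card (geq_minl #|A' j| #|B' j|).
  have [B2 B2B' B2k] := subset_of_card (geq_minr #|A' j| #|B' j|).
  have A2A := subset_trans A2A' A'A; have B2B := subset_trans B2B' B'B.
  (* Goodness passes to the thinned pair with the old threshold [#|A j| %/ q]. *)
  have [|||Pj [PjS Pj_uniq Pj_sorted Pj_size]] :=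
      @long_path_of_bipartite T h A2 B2 (#|A j| %/ q) h_sym.
  - by apply: disjointWl A2A _; apply: disjointWr B2B _.
  - by rewrite A2k B2k.
  - move=> X Y XA2 YB2; apply: joinedAB; [exact: subset_trans XA2 A2A|].
    exact: subset_trans YB2 B2B.
  exists Pj; split=> //.
    by move=> x /PjS; rewrite !inE => /orP[/(subsetP A2A')->|/(subsetP B2B')->]; rewrite ?orbT.
  have [cA cB] := card' j; rewrite A2k -/k in Pj_size.
  have : #|A j| <= N * k + l j + N * 8 ^ J.
    by rewrite -cAB in cB; rewrite /k; case: (leqP #|A' j| #|B' j|).
  move/(leq_mul (leqnn N)): Pj_size; rewrite cardQ.
  move: #|A j| (8 ^ J) (size Pj) (k) (l j) (#|A j| %/ q) => b e a k' c d; clear; lia.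
have {path_j} /fin_all_exists[Pt PtP] := path_j.
pose Ps := map Pt (enum 'I_J).
have [||t [t_path t_sub t_out t_size]] := @glue_paths T G h hG m Ps joined.
- by move=> _ /mapP[j _ ->]; have [] := PtP j.
- apply: uniq_flatten_map; first exact: enum_uniq.
    by move=> j; have [] := PtP j.
  move=> i j x xi xj; apply: (disj' i j x).
    by have [/(_ x xi)] := PtP i.
  by have [/(_ x xj)] := PtP j.
have sizePs : size Ps = J by rewrite size_map size_enum_ord.
rewrite sizePs in t_out t_size.
pose g := excess N s; pose X := \sum_j #|A j| %/ q.
have loadE : \sum_v load s v = \sum_j #|Q j|.
  by rewrite sum_load (big_nth set0) big_mkord.
have g_le v : load s v <= N + g v by rewrite /g /excess; lia.
have sum_c : \sum_v load s v <= N * #|T| + \sum_v g v.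
  rewrite mulnC -sum_nat_const -big_split; apply: leq_sum => v _; exact: g_le.
(* A crude bound: [g <= 2 g - 1], also at [g = 0] thanks to truncation. With [sum_c] and [4 D <= N]
   it gives [g4] and [c2]. *)
have sum_g1 : N * \sum_v g v <= 2 * D * \sum_v load s v.
  apply: leq_trans rem_s; rewrite leq_mul2l; apply/orP; right.
  by apply: leq_sum => v _; rewrite -/(g v); lia.
(* The sharp bound keeps the factor 2 at the price of [N * #|T|]; it makes the weight of the cover
   about half the number of packed vertices. *)
have sum_g2 : 2 * N * \sum_v g v <= 2 * D * \sum_v load s v + N * #|T|.
  have : 2 * \sum_v g v <= \sum_v (2 * g v - 1) + #|T|.
    rewrite -sum1_card big_distrr -big_split; apply: leq_sum => v _ /=; lia.
  by move: rem_s; rewrite -/g; nia.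
have g4 : \sum_v g v <= 4 * D * #|T| by nia.
have c2 : \sum_v load s v <= 2 * N * #|T| by nia.
have sum_l' : \sum_j l j <= \sum_v g v.
  apply: leq_trans sum_l _; apply: leq_sum => v _.
  by rewrite /g /excess load_nth.
have sum_paths : \sum_j #|Q j| <= N * size (flatten Ps) + 2 * \sum_j l j
      + J * (N * (2 * 8 ^ J + 1)) + 4 * N * X.
  have -> : size (flatten Ps) = \sum_j size (Pt j).
    by rewrite size_flatten sumnE /shape -map_comp big_map big_enum.
  have -> : J * (N * (2 * 8 ^ J + 1)) = \sum_(j < J) N * (2 * 8 ^ J + 1).
    by rewrite sum_nat_const card_ord.
  rewrite /X !big_distrr -!big_split; apply: leq_sum => j _.
  by have [_ _ _] := PtP j.
have sumA : \sum_j #|Q j| = 2 * \sum_j #|A j|.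
  by rewrite big_distrr; apply: eq_bigr.
have qX : q * X <= \sum_j #|A j|.
  by rewrite big_distrr; apply: leq_sum => j _ /=; rewrite mulnC leq_trunc_div.
have Jm0 : J * m0 <= \sum_j #|A j|.
  rewrite -[J in J * _]card_ord -sum_nat_const; apply: leq_sum => j _.
  by have [] := AB j.
exists g, t, J, X; split=> //.
- by rewrite loadE sumA in c2; split; lia.
- rewrite loadE in sum_g2; apply: leq_trans sum_g2 _.
  rewrite addnC leq_add2l leq_mul2l; apply/orP; right.
  apply: leq_trans sum_paths _; have NF := leq_mul (leqnn N) t_size.
  have Ll : 2 * \sum_j l j <= 8 * D * #|T| by lia.
  by rewrite !leq_add2r; clear -NF Ll; move: (8 ^ J) => e; lia.
move=> A0 B0 dAB m0A gAB.
have PQ : P (A0 :|: B0) by exists A0, B0.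
have := add_s _ PQ.
rewrite cardsU (disjoint_setI0 dAB) cards0 subn0.
rewrite (eq_bigl (fun v => (v \in A0) || (v \in B0))); last by move=> v; rewrite inE.
rewrite bigU //=.
have [<- _] := gAB.
have sumS (C : {set T}) : \sum_(v in C) (2 * excess N s v + 1) = 2 * \sum_(v in C) g v + #|C|.
  by rewrite big_split /= sum1_card big_distrr.
by rewrite !sumS; have [<- _] := gAB; nia.
Qed.

End AlmostMonochromaticPath.

(** * Roundings *)

(** By disjointness an edge between [U] and [W] determines which end lies in [U], so edges
    correspond to ordered pairs. *)
Lemma nb_edges_density (T : finType) (G : sgraph T) (R : realType) (U W : {set T}) :
  [disjoint U & W] ->
  density G R U W = ((nb_edges G U W)%:R / (#|U|%:R * #|W|%:R))%R.
Proof.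
move=> dUW; rewrite /density; congr (_%:R / _)%R.
pose E := [set e in setX U W | G e.1 e.2].
have -> : edges_between G U W = [set [set e.1; e.2] | e in E].
  apply/setP => S; apply/idP/imsetP.
    rewrite inE => /andP[/imset2P[x y _]]; rewrite inE => /andP[_ Gxy] Sxy.
    case/existsP => u /andP[uU /existsP[w /andP[wW /eqP Suw]]].
    exists (u, w) => //; rewrite !inE uU wW /=.
    have uw : u != w by apply: contraTneq uU => ->; rewrite (disjointFl dUW).
    have : u \in [set x; y] by rewrite -Sxy Suw set21.
    have : w \in [set x; y] by rewrite -Sxy Suw set22.
    rewrite !inE; case/orP => /eqP w_eq; case/orP => /eqP u_eq; move: uw;
      rewrite ?w_eq ?u_eq ?eqxx // => _; by rewrite ?Gxy // adj_sym.
  case=> -[u w]; rewrite !inE /= => /andP[/andP[uU wW] Guw] ->.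
  apply/andP; split; first by apply/imset2P; exists u w; rewrite ?inE.
  by apply/existsP; exists u; rewrite uU; apply/existsP; exists w; rewrite wW /=.
rewrite card_in_imset.
  rewrite /nb_edges pair_big -sum1_card [RHS]big_mkcond [LHS]big_mkcond.
  apply: eq_bigr => -[u w] _; rewrite !inE /=.
  by case: (u \in U); case: (w \in W); case: (G u w).
move=> [u w] [u' w']; rewrite !inE /= => /andP[/andP[uU wW] _] /andP[/andP[u'U w'W] _] eqS.
have /set2P[uu|uw] : u \in [set u'; w'] by rewrite -eqS set21.
  have /set2P[wu|ww] : w \in [set u'; w'] by rewrite -eqS set22.
    by move: wW; rewrite wu (disjointFr dUW).
  by rewrite uu ww.
by move: uU; rewrite uw (disjointFl dUW).
Qed.

Lemma sum_ord_ltn (D y : nat) : \sum_(t < D) (t < y) = minn D y.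
Proof.
elim: D => [|D IHD]; first by rewrite big_ord0 min0n.
by rewrite big_ord_recr IHD /=; case: ltnP; lia.
Qed.

(* Twice the half-integral rounding of the fractional cover [x / (2 D)] at
   threshold [t / (2 D)]; its average over [t] is about [x / D]. *)
Definition rounding (D t x : nat) : nat := (t <= x) + (2 * D - t <= x).

(** The first threshold is met [minn D x.+1] times and, reflecting [t], the second one
    [minn D (x - D)] times. *)
Lemma sum_rounding (D x : nat) : \sum_(t < D) rounding D t x <= x.+1.
Proof.
rewrite big_split /= (sum_ord_ltn D x.+1).
have -> : \sum_(t < D) (2 * D - t <= x) = \sum_(t < D) (t < x - D).
  rewrite (reindex_inj rev_ord_inj); apply: eq_bigr => t _ /=; congr nat_of_bool.
  by have := ltn_ord t; lia.
by rewrite sum_ord_ltn; lia.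
Qed.

Lemma exists_rounding (T : finType) (D : nat) (g : T -> nat) : 0 < D ->
  exists2 t, t < D & D * \sum_v rounding D t (g v) <= \sum_v g v + #|T|.
Proof.
move=> D_gt0; apply: contrapT => none.
have : \sum_(t < D) (\sum_v g v + #|T|).+1 <= \sum_(t < D) D * \sum_v rounding D t (g v).
  by apply: leq_sum => t _; rewrite ltnNge; apply/negP => le; apply: none; exists t.
rewrite sum_nat_const card_ord -big_distrr leq_pmul2l // leqNgt => /negP; apply.
rewrite exchange_big ltnS -sum1_card -big_split; apply: leq_sum => v _.
by rewrite /= addn1; apply: sum_rounding.
Qed.

(* If all members of an intersecting family of roundings have weight at least
   [2] (that is, [1] after halving), take any [i]; otherwise one of them is
   [1] at a single colour [i], and the others must meet it there or have
   weight [2]. *)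
Lemma intersecting_colour (T : finType) (r : nat) (w : T -> 'I_r -> nat) (S : {set T}) :
  0 < r ->
  {in S &, forall u v, exists i, 2 <= w u i + w v i} ->
  exists i, {in S, forall v, 2 <= \sum_k w v k + w v i}.
Proof.
move=> r_gt0 meet.
have [[u [uS wu]]|none] := pselect (exists u, u \in S /\ \sum_k w u k <= 1); last first.
  exists (Ordinal r_gt0) => v vS; apply: leq_trans (leq_addr _ _).
  by rewrite leqNgt; apply/negP => wv; apply: none; exists v.
have [i wui] := meet u u uS uS; exists i => v vS.
have [k wuvk] := meet u v uS vS.
have lew j : w v j <= \sum_k w v k by rewrite (bigD1 j) //= leq_addr.
move: wu (lew i) (lew k); move: (\sum_k w v k) => a.
rewrite (bigD1 i) //=; have [ki|ki] := eqVneq k i.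
  by rewrite ki in wuvk; move: (\sum_(j < r | j != i) w u j) => b; clear -wuvk; lia.
rewrite (bigD1 k) //=; move: (\sum_(j < r | (j != i) && (j != k)) w u j) => b.
by clear -wui wuvk; lia.
Qed.

Lemma card_small_fibers (T F : finType) (f : T -> F) (b : nat) :
  #|[set v | #|[set u | f u == f v]| < b]| <= #|F| * b.
Proof.
rewrite (card_fibers f) -sum_nat_const; apply: leq_sum => x _.
have [->|[v]] := set_0Vmem [set v in [set v | #|[set u | f u == f v]| < b] | f v == x].
  by rewrite cards0.
rewrite !inE => /andP[small /eqP fv]; apply: leq_trans (ltnW small).
by apply/subset_leq_card/subsetP => u; rewrite !inE fv => /andP[].
Qed.

Local Open Scope ring_scope.

(** * The two alternatives for a colour *)

Lemma exists_nat_ge (R : realType) (x : R) : exists n : nat, (0 < n)%N /\ x <= n%:R.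
Proof.
exists (Num.bound `|x|).+1; split=> //.
apply: le_trans (ler_norm x) _; apply: ltW; apply: lt_le_trans (archi_boundP _) _ => //.
by rewrite ler_nat.
Qed.

Lemma bernoulli (R : realType) (x : R) (t : nat) : 0 <= x -> 1 + t%:R * x <= (1 + x) ^+ t.
Proof.
move=> x_ge0; elim: t => [|t IHt]; first by rewrite mul0r addr0.
rewrite exprS; apply: le_trans (ler_wpM2l _ IHt); last by rewrite addr_ge0.
have := mulr_ge0 (mulr_ge0 (ler0n R t) x_ge0) x_ge0; rewrite -natr1; lra.
Qed.

(** If [U], [W] were dense, equally large subsets of them would contain a good pair, whose cover
    weight is at least [2 D - 1] per vertex of [A], while [t1 + t2 <= 2 D - 2]. *)
Lemma sparse_of_no_good_pair (T : finType) (h : rel T) (g : T -> nat) (R : realType)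
    (kappa p : R) (D q m0 t : nat) (U W : {set T}) (t1 t2 : nat) :
  0 < kappa -> 0 < p -> (1 < q)%N -> (0 < m0)%N -> [disjoint U & W] ->
  (forall X Y : {set T}, [disjoint X & Y] -> (m0 <= #|X|)%N -> (m0 <= #|Y|)%N ->
    (nb_edges h X Y)%:R < 2 * p * #|X|%:R * #|Y|%:R) ->
  (forall A B : {set T}, [disjoint A & B] -> (m0 <= #|A|)%N -> good_pair h q A B ->
      ((2 * D - 1) * #|A| <= \sum_(v in A) g v + \sum_(v in B) g v)%N) ->
  2 <= kappa * (1 + (4 * q%:R ^+ 2)^-1) ^+ t ->
  (t1 + t2 + 2 <= 2 * D)%N ->
  {in U, forall u, g u <= t1}%N -> {in W, forall w, g w <= t2}%N ->
  (m0 * (2 * q) ^ t <= #|U|)%N -> (m0 * (2 * q) ^ t <= #|W|)%N ->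
  (nb_edges h U W)%:R < kappa * p * #|U|%:R * #|W|%:R.
Proof.
move=> kappa_gt0 p_gt0 q_gt1 m0_gt0 dUW upper heavy large_t tD gU gW mU mW.
rewrite ltNge; apply/negP => dense.
have [A [B [AU BW Ak Bk le]]] := leq_density_subsets h
  (geq_minl #|U| #|W|) (geq_minr #|U| #|W|).
set a := minn _ _ in Ak Bk le.
have ma : (m0 * (2 * q) ^ t <= a)%N by rewrite /a leq_min mU.
have pow_gt0 : (0 < m0 * (2 * q) ^ t)%N by rewrite muln_gt0 m0_gt0 expn_gt0 muln_gt0 /=; lia.
have AB : #|A| = #|B| by rewrite Ak.
have disjsub (X Y : {set T}) : X \subset A -> Y \subset B -> [disjoint X & Y].
  move=> XA YB; apply: disjointWl (subset_trans XA AU) _.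
  exact: disjointWr (subset_trans YB BW) _.
have denseAB : kappa * p * a%:R * a%:R <= (nb_edges h A B)%:R.
  have UW_gt0 : 0 < #|U|%:R * #|W|%:R :> R.
    by rewrite mulr_gt0 // ltr0n; clear -ma pow_gt0 mU mW; lia.
  rewrite -(ler_pM2l UW_gt0).
  have leR : a%:R * a%:R * (nb_edges h U W)%:R <= #|U|%:R * #|W|%:R * (nb_edges h A B)%:R :> R.
    by rewrite -!natrM ler_nat.
  apply: le_trans leR; have aa : 0 <= a%:R * a%:R :> R by rewrite mulr_ge0.
  by have := ler_wpM2l aa dense; lra.
have [||||A' [B' [A'A B'B mA' gAB]]] := @good_pair_in_dense T h q q_gt1 R p m0 t A B AB.
- by rewrite Ak.
- by [].
- by move=> X Y XA YB; apply: upper; apply: disjsub.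
- rewrite Ak; set s := (1 + _) ^+ t in large_t *.
  have s_ge0 : 0 <= s.
    by rewrite exprn_ge0 // addr_ge0 // invr_ge0 mulr_ge0 // exprn_ge0.
  apply: le_trans (ler_wpM2r s_ge0 denseAB).
  have paa : 0 <= p * a%:R * a%:R by rewrite !mulr_ge0 // ltW.
  by have := ler_wpM2r paa large_t; lra.
have A'B' : #|A'| = #|B'| by case: gAB.
have := heavy A' B' (disjsub _ _ A'A B'B) mA' gAB.
have sA : (\sum_(v in A') g v <= t1 * #|A'|)%N.
  rewrite mulnC -sum_nat_const; apply: leq_sum => v vA'.
  exact/gU/(subsetP AU)/(subsetP A'A).
have sB : (\sum_(v in B') g v <= t2 * #|A'|)%N.
  rewrite A'B' mulnC -sum_nat_const; apply: leq_sum => v vB'.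
  exact/gW/(subsetP BW)/(subsetP B'B).
have A'_gt0 : (0 < #|A'|)%N by apply: leq_trans mA'.
move: sA sB tD; clear -A'_gt0; move: (\sum_(v in A') _)%N (\sum_(v in B') _)%N => sA sB.
by nia.
Qed.

Lemma nb_edges_gt0 (T : finType) (h : rel T) (U W : {set T}) :
  (0 < nb_edges h U W)%N -> exists u w, [/\ u \in U, w \in W & h u w].
Proof.
apply: contraPP => no_edge; apply/negP; rewrite -leqNgt leqn0.
apply/eqP; apply: big1 => u uU; apply: big1 => w wW.
by case huw: (h u w) => //; case: no_edge; exists u, w.
Qed.

(** [path_from_packing] yields [g] and the path, and [sparse_of_no_good_pair] turns the cover
    condition into sparsity; what remains is to choose constants that keep all errors below
    [e * #|T|]. *)
Lemma excess_or_path (R : realType) (kappa eta e : R) (D : nat) :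
  0 < kappa -> 0 < eta <= 1 -> 0 < e -> (0 < D)%N -> 1 <= e * D%:R ->
  exists (gamma : R) (K n0 : nat), 0 < gamma <= 1 / 2 /\ gamma <= eta /\
  forall (T : finType) (G h : rel T) (p : R),
  0 < p -> (n0 <= #|T|)%N -> symmetric h -> subrel h G ->
  (forall U W : {set T}, [disjoint U & W] ->
    gamma * #|T|%:R <= #|U|%:R -> gamma * #|T|%:R <= #|W|%:R ->
    (0 < nb_edges G U W)%N /\ (nb_edges G U W)%:R < 2 * p * #|U|%:R * #|W|%:R) ->
  exists (g : T -> nat) (s : seq T),
  [/\ uniq s && sorted G s, (nb_steps_outside h s <= K)%N,
      (\sum_v g v)%:R <= D%:R * ((size s)%:R + e * #|T|%:R)
    & forall (t1 t2 : nat) (U W : {set T}),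
      [disjoint U & W] -> (t1 + t2 + 2 <= 2 * D)%N ->
      {in U, forall u, g u <= t1}%N -> {in W, forall w, g w <= t2}%N ->
      eta * #|T|%:R <= #|U|%:R -> eta * #|T|%:R <= #|W|%:R ->
      (nb_edges h U W)%:R < kappa * p * #|U|%:R * #|W|%:R].
Proof.
move=> kappa_gt0 /andP[eta_gt0 eta_le1] e_gt0 D_gt0 eD.
(* [N] absorbs the excess and [q] the ends missed by depth-first search; [t] increments lift density
   [kappa p] to [2 p]. Good pairs then have size about [d n], so at most [K] occur; [gamma] makes
   gluing cheap. *)
have [N0 [N0_gt0 N0_ge]] := exists_nat_ge (64 * D%:R / e).
pose N := maxn N0 (4 * D).
have [q0 [q0_gt0 q0_ge]] := exists_nat_ge (32 * N%:R / e).
pose q := q0.+1; pose s : R := (4 * q%:R ^+ 2)^-1.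
have [t [_ t_ge]] := exists_nat_ge (2 / (kappa * s)).
pose d : R := eta / ((2 * q) ^ t)%:R.
have [K [_ K_ge]] := exists_nat_ge (2 * N%:R / d).
pose gamma := d / (2 + 32 * K%:R / e).
have [n0 [_ n0_ge]] := exists_nat_ge (2 / d + 8 * (K * (2 * 8 ^ K + 3))%:R / e).
have D_gt0R : 0 < D%:R :> R by rewrite ltr0n.
have N_gt0 : (0 < N)%N by apply: leq_trans N0_gt0 (leq_maxl _ _).
have N_gt0R : 0 < N%:R :> R by rewrite ltr0n.
have N_ge : 64 * D%:R <= N%:R * e.
  rewrite -ler_pdivrMr //; apply: le_trans N0_ge _.
  by rewrite ler_nat leq_maxl.
have q_ge : 32 * N%:R <= q%:R * e.
  rewrite -ler_pdivrMr //; apply: le_trans q0_ge _.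
  by rewrite ler_nat.
have q_gt1 : (1 < q)%N by rewrite ltnS.
have q_gt0R : 0 < q%:R :> R by rewrite ltr0n.
have s_gt0 : 0 < s by rewrite invr_gt0 mulr_gt0 // exprn_gt0.
have large_t : 2 <= kappa * (1 + s) ^+ t.
  apply: le_trans (ler_wpM2l (ltW kappa_gt0) (bernoulli t (ltW s_gt0))).
  have := mulr_gt0 kappa_gt0 s_gt0.
  by move: t_ge; rewrite ler_pdivrMr ?mulr_gt0 //; lra.
have pow_gt0 : 0 < ((2 * q) ^ t)%:R :> R.
  by rewrite ltr0n expn_gt0 muln_gt0 /q.
have d_gt0 : 0 < d by rewrite divr_gt0.
have d_eta : d * ((2 * q) ^ t)%:R = eta by rewrite divfK ?gt_eqF.
have pow_ge1 : 1 <= ((2 * q) ^ t)%:R :> R by move: pow_gt0; rewrite ltr0n ler1n.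
have d_le : d <= eta by rewrite -d_eta ler_peMr // ltW.
have K_ge' : 2 * N%:R <= K%:R * d by rewrite -ler_pdivrMr.
have den_gt0 : 0 < 2 + 32 * K%:R / e :> R.
  by rewrite ltr_wpDr // divr_ge0 // ?mulr_ge0 // ltW.
have gamma_gt0 : 0 < gamma by rewrite divr_gt0.
have gammaE : gamma * (2 + 32 * K%:R / e) = d by rewrite divfK ?gt_eqF.
have Ke_ge0 : 0 <= K%:R / e by rewrite divr_ge0 // ltW.
have gKe_ge0 : 0 <= gamma * (K%:R / e) by rewrite mulr_ge0 // ltW.
have gamma2 : 2 * gamma <= d by rewrite -gammaE; lra.
have gammaK : 32 * (gamma * K%:R) <= e.
  have : gamma * K%:R = gamma * (K%:R / e) * e by rewrite -mulrA divfK ?gt_eqF.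
  have : 32 * (gamma * (K%:R / e)) <= 1 by move: gammaE; lra.
  by move=> /(ler_wpM2r (ltW e_gt0)); lra.
exists gamma, K, n0; split; first by rewrite gamma_gt0 /=; lra.
split; first by lra.
move=> T G h p p_gt0 n0T h_sym hG pseudo.
set n : R := #|T|%:R in pseudo *.
have n_ge : 2 / d + 8 * (K * (2 * 8 ^ K + 3))%:R / e <= n.
  by apply: le_trans n0_ge _; rewrite ler_nat.
have dn : 2 <= d * n.
  rewrite mulrC -ler_pdivrMr //; apply: le_trans n_ge; rewrite lerDl.
  by rewrite divr_ge0 ?mulr_ge0 // ltW.
have en : 8 * (K * (2 * 8 ^ K + 3))%:R <= e * n.
  rewrite mulrC [e * n]mulrC -ler_pdivrMr // mulrC; apply: le_trans n_ge; rewrite lerDr.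
  by rewrite divr_ge0 // ltW.
have n_gt0 : 0 < n by rewrite -(pmulr_rgt0 _ d_gt0); clear -dn; lra.
pose m := (Num.truncn (gamma * n)).+1; pose m0 := Num.truncn (d * n).
have /andP[m_le m_gt] := truncn_itv (mulr_ge0 (ltW gamma_gt0) (ltW n_gt0)).
have /andP[m0_le] := truncn_itv (mulr_ge0 (ltW d_gt0) (ltW n_gt0)).
rewrite -natr1 -/m0 => m0_gt.
have m0_ge : d * n <= 2 * m0%:R by clear -m0_gt dn; lra.
have m_le1 : m%:R <= gamma * n + 1 by rewrite /m -natr1; clear -m_le; lra.
have gamma_m0 : gamma * n <= m0%:R.
  by have := ler_wpM2r (ltW n_gt0) gamma2; clear -m0_ge; lra.
have m0_gt0 : (0 < m0)%N by rewrite -(ltr0n R); clear -m0_ge dn; lra.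
have joined (U W : {set T}) : [disjoint U & W] -> #|U| = m -> #|W| = m ->
    exists u w, [/\ u \in U, w \in W & G u w].
  move=> dUW Um Wm; apply: nb_edges_gt0; have [] // := pseudo U W dUW.
    by rewrite Um ltW.
  by rewrite Wm ltW.
have [g [P [J [X [P_path P_out [Jm0 qX] sum_g heavy]]]]] :=
  path_from_packing q m0 h_sym hG D_gt0 (leq_maxr N0 (4 * D)) joined.
rewrite -/N in Jm0 qX sum_g.
have upper (U W : {set T}) : [disjoint U & W] -> (m0 <= #|U|)%N -> (m0 <= #|W|)%N ->
    (nb_edges h U W)%:R < 2 * p * #|U|%:R * #|W|%:R.
  rewrite -!(ler_nat R) => dUW mU mW.
  have [_] := pseudo U W dUW (le_trans gamma_m0 mU) (le_trans gamma_m0 mW).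
  apply: le_lt_trans; rewrite ler_nat; apply: leq_sum => u _; apply: leq_sum => w _.
  by case huw: (h u w) => //; rewrite (hG _ _ huw).
have JK : (J <= K)%N.
  rewrite -(ler_nat R) -(ler_pM2r d_gt0); apply: le_trans K_ge'.
  rewrite -(ler_pM2r n_gt0).
  have : J%:R * m0%:R <= N%:R * n by rewrite -!natrM ler_nat.
  have := ler_wpM2l (ler0n R J) m0_ge; clear; lra.
exists g, P; split=> //; first exact: leq_trans P_out JK.
- have JM : J%:R * (2 * 8 ^ J + 3)%:R <= e * n / 8.
    have : (J * (2 * 8 ^ J + 3) <= K * (2 * 8 ^ K + 3))%N.
      by apply: leq_mul => //; rewrite leq_add2r leq_mul2l leq_pexp2l.
    by rewrite -(ler_nat R) natrM; clear -en; lra.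
  have mJ : m%:R * J%:R <= e * n / 32 + J%:R.
    have JKR : J%:R <= K%:R :> R by rewrite ler_nat.
    have := ler_wpM2r (ler0n R J) m_le1.
    have := ler_wpM2l (mulr_ge0 (ltW gamma_gt0) (ltW n_gt0)) JKR.
    have := ler_wpM2r (ltW n_gt0) gammaK; clear; lra.
  have Xe : X%:R <= e * n / 32.
    have : q%:R * X%:R <= N%:R * n by rewrite -!natrM ler_nat.
    move=> /(ler_wpM2r (ltW e_gt0)) qXe.
    have := ler_wpM2r (ler0n R X) q_ge => NX.
    by rewrite -(ler_pM2l N_gt0R); clear -qXe NX; lra.
  (* Half of the error [e n] pays for the summand [N n] of [sum_g], the other half for [inner]. *)
  have eDn : n <= e * D%:R * n by rewrite ler_peMl // ltW.
  have Nen := ler_wpM2r (ltW n_gt0) N_ge.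
  move: sum_g; rewrite -(ler_nat R) !(natrM, natrD) -/n natrX => sum_g.
  rewrite natrD natrM natrX in JM.
  set z : R := (size P)%:R in sum_g *; set E : R := 8%:R ^+ J in JM sum_g.
  have en_ge0 : 0 <= e * n by rewrite mulr_ge0 // ltW.
  have inner : N%:R * (z + 2 * m%:R * J%:R) + 8 * D%:R * n
      + J%:R * N%:R * (2 * E + 1) + 4 * N%:R * X%:R <= N%:R * (z + e * n / 2).
    have : 2 * (m%:R * J%:R) + J%:R * (2 * E + 1) + 4 * X%:R <= e * n * 3 / 8.
      by clear -mJ JM Xe en_ge0; lra.
    by move=> /(ler_wpM2l (ltW N_gt0R)); clear -Nen; lra.
  have D2_ge0 : 0 <= 2 * D%:R :> R by rewrite mulr_ge0.
  have := ler_wpM2l D2_ge0 inner; have := ler_wpM2l (ltW N_gt0R) eDn.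
  have N2_gt0 : 0 < 2 * N%:R :> R by rewrite mulr_gt0.
  by move=> Nn inner'; rewrite -(ler_pM2l N2_gt0); clear -sum_g Nn inner'; lra.
move=> t1 t2 U W dUW t12 gU gW eU eW.
have large (S : {set T}) : eta * n <= #|S|%:R -> (m0 * (2 * q) ^ t <= #|S|)%N.
  move=> eS; rewrite -(ler_nat R) natrM; apply: le_trans eS; rewrite -d_eta.
  by have := ler_wpM2r (ltW pow_gt0) m0_le; clear; lra.
by apply: (@sparse_of_no_good_pair T h g R kappa p D q m0 t U W t1 t2) => //; apply: large.
Qed.

(* An edge colouring is a function on all vertex sets, of which only the
   values on edges are used. *)
Theorem theorem3p1 (R : realType) (r : nat) (eps : R)
    (hr : (2 <= r)%N) (heps : 0 < eps) :
  exists (gamma : R) (K : nat), 0 < gamma <= 1 /\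
  exists n0 : nat,
  forall (T : finType) (G : sgraph T) (p : R),
    0 < p <= 1 -> (n0 <= #|T|)%N -> pseudorandom G gamma p ->
  forall c : {set T} -> 'I_r,
  exists (x : T) (s : seq T) (i : 'I_r),
    [/\ is_path G x s,
        (2 / (r%:R + 1) - eps) * #|T|%:R <= (size s)%:R
      & (count (fun e => c e != i) (path_edges x s) <= K)%N].
Proof.

(* Constants and pseudorandomness *)
have r_gt0 : (0 < r)%N by apply: ltnW.
have r_gt0R : 0 < r%:R :> R by rewrite ltr0n.
(* If all [r] colours have density at most [kappa p], the total is at most [p / 4], against [p / 2]
   from pseudorandomness. *)
pose kappa : R := (4 * r%:R)^-1; pose e := eps / 8.
have kappa_gt0 : 0 < kappa by rewrite invr_gt0 mulr_gt0.
have kappa_r : 4 * r%:R * kappa = 1 by rewrite divff // gt_eqF // mulr_gt0.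
have e_gt0 : 0 < e by rewrite divr_gt0.
have [D [D_gt0 D_ge]] := exists_nat_ge e^-1.
have eD : 1 <= e * D%:R by rewrite mulrC -ler_pdivrMr // div1r.
(* Rare types contain at most [4 ^ r * (2 * a)] vertices, with [a] about [eta n]; doubled, this is
   [M * a], and [eta] makes [eta * M <= eps / 4]. *)
pose M : nat := (4 ^ r.+1)%N.
have M_ge1 : 1 <= M%:R :> R by rewrite ler1n expn_gt0.
have M_gt0 : 0 < M%:R :> R by apply: lt_le_trans M_ge1.
have eps4_gt0 : 0 < 4 / eps by rewrite divr_gt0.
have den_gt0 : 0 < M%:R * (1 + 4 / eps) by rewrite mulr_gt0 // addr_gt0.
pose eta := (M%:R * (1 + 4 / eps))^-1.
have eta_gt0 : 0 < eta by rewrite invr_gt0.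
have etaM1 : eta * M%:R * (1 + 4 / eps) = 1 by rewrite -mulrA mulVf // gt_eqF.
have etaM_gt0 : 0 < eta * M%:R by rewrite mulr_gt0.
have eta_M : eta * M%:R * 4 <= eps.
  have : eta * M%:R * (4 / eps) <= 1 by move: etaM1; rewrite mulrDr; lra.
  by rewrite mulrA ler_pdivrMr // mul1r.
have eta_le1 : eta <= 1.
  have := ler_wpM2l (ltW eta_gt0) M_ge1.
  have := mulr_gt0 etaM_gt0 eps4_gt0; move: etaM1; rewrite mulrDr; lra.
have [|gamma [K [n1 [/andP[gamma_gt0 gamma_le] [gamma_eta main]]]]] :=
  @excess_or_path R kappa eta e D kappa_gt0 _ e_gt0 D_gt0 eD.
  by rewrite eta_gt0.
have [n2 [n2_gt0 n2_ge]] := exists_nat_ge (8 * M%:R / eps + 8 / eps).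
exists gamma, K; split; first by rewrite gamma_gt0 /=; lra.
exists (n1 + n2)%N => T G p /andP[p_gt0 _] nT pseudo c.
apply: contrapT => no_path.
pose h i := (fun x y => G x y && (c [set x; y] == i)) : rel T.
set n : R := #|T|%:R in pseudo no_path.
have n_ge : n2%:R <= n by rewrite ler_nat; apply: leq_trans nT; apply: leq_addl.
have n_gt0 : 0 < n by apply: lt_le_trans n_ge; rewrite ltr0n.
have epsn8M : 8 * M%:R <= eps * n.
  rewrite mulrC [eps * n]mulrC -ler_pdivrMr // mulrC.
  by apply: le_trans (le_trans n2_ge n_ge); rewrite lerDl divr_ge0 // ltW.
have epsn8 : 8 <= eps * n.
  by apply: le_trans epsn8M; rewrite ler_peMr.
have count_edges (U W : {set T}) : [disjoint U & W] ->
    gamma * n <= #|U|%:R -> gamma * n <= #|W|%:R ->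
    [/\ 0 < p * #|U|%:R * #|W|%:R,
        p / 2 * #|U|%:R * #|W|%:R <= (nb_edges G U W)%:R
      & (nb_edges G U W)%:R < 2 * p * #|U|%:R * #|W|%:R].
  move=> dUW gU gW; have := pseudo U W dUW gU gW.
  have gn_gt0 : 0 < gamma * n by rewrite mulr_gt0.
  have U_gt0 := lt_le_trans gn_gt0 gU; have W_gt0 := lt_le_trans gn_gt0 gW.
  have UW_gt0 := mulr_gt0 U_gt0 W_gt0.
  have pUW_gt0 := mulr_gt0 p_gt0 UW_gt0.
  rewrite nb_edges_density // ler_norml lerBrDr lerBlDr.
  rewrite ler_pdivlMr // ler_pdivrMr // => /andP[lo up].
  have := ler_wpM2r (ltW pUW_gt0) gamma_le.
  by clear -lo up pUW_gt0; split; lra.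
have h_sym i : symmetric (h i) by move=> x y; rewrite /h adj_sym setUC.
have hG i : subrel (h i) G by move=> x y /andP[].
have pseudo' (U W : {set T}) : [disjoint U & W] ->
    gamma * n <= #|U|%:R -> gamma * n <= #|W|%:R ->
    (0 < nb_edges G U W)%N /\ (nb_edges G U W)%:R < 2 * p * #|U|%:R * #|W|%:R.
  move=> dUW gU gW; have [pUW_gt0 lo up] := count_edges U W dUW gU gW.
  by split=> //; rewrite -(ltr0n R); lra.
have {main} /fin_all_exists[g /fin_all_exists[s gs]] i := 
  main T G (h i) p p_gt0 (leq_trans (leq_addr n2 n1) nT) (h_sym i) (hG i) pseudo'.
(* [size (s i)] counts vertices, one more than the length. *)
have s_short i : (size (s i))%:R <= (2 / (r%:R + 1) - eps) * n + 1.
  have [/andP[s_uniq s_sorted] s_out _ _] := gs i.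
  rewrite leNgt; apply/negP => s_long; apply: no_path.
  case E : (s i) s_uniq s_sorted s_out s_long => [|x s'] s_uniq s_sorted s_out s_long.
    have /card_gt0P[x _] : (0 < #|T|)%N by rewrite -(ltr0n R).
    by exists x, [::], i; split=> //=; move: s_long => /=; lra.
  exists x, s', i; split.
  - by rewrite /is_path s_uniq andbT.
  - by move: s_long; rewrite /= -natr1; lra.
  - apply: leq_trans s_out; rewrite /path_edges count_map; apply: sub_count => -[u v] /= cuv.
    by rewrite /h (negPf cuv) andbF.

(* Roundings at typical vertices meet *)
have /fin_all_exists2[t tD sum_t] i := exists_rounding (g i) D_gt0.
pose w v i := rounding D (t i) (g i v).
pose f v := [ffun i => (t i <= g i v, 2 * D - t i <= g i v)%N].
pose a := (Num.truncn (eta * n)).+1.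
have /andP[a_le a_gt] := truncn_itv (mulr_ge0 (ltW eta_gt0) (ltW n_gt0)).
have a_le1 : a%:R <= eta * n + 1 by rewrite /a -natr1; lra.
have fw u v i : f u = f v -> w u i = w v i.
  by move=> /ffunP/(_ i); rewrite !ffunE /w /rounding => -[-> ->].
(* With [2 * a] vertices in a type, disjoint sets of size [a] exist even when [u] and [v] have the
   same type. *)
pose S := [set v | (2 * a <= #|[set u | f u == f v]|)%N].
have cardS : (#|T| <= #|S| + 4 ^ r * (2 * a))%N.
  rewrite -(cardC S) leq_add2l.
  have <- : #|{ffun 'I_r -> bool * bool}| = (4 ^ r)%N.
    by rewrite card_ffun card_prod card_bool card_ord.
  apply: leq_trans (card_small_fibers f (2 * a)).
  by apply/subset_leq_card/subsetP => v; rewrite !inE -ltnNge.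
have meet : {in S &, forall u v, exists i, 2 <= w u i + w v i}%N.
  move=> u v; rewrite !inE => uS vS; apply: contrapT => no_i.
  have [U Uu Ua] : exists2 U : {set T}, U \subset [set x | f x == f u] & #|U| = a.
    by apply: subset_of_card; apply: leq_trans uS; rewrite leq_pmull.
  pose W := [set x | f x == f v] :\: U.
  have Wa : (a <= #|W|)%N.
    have := cardsID U [set x | f x == f v]; rewrite -/W.
    have := subset_leq_card (subsetIr [set x | f x == f v] U).
    by clear -Ua vS; lia.
  have dUW : [disjoint U & W] by rewrite disjoint_sym disjoints_subset /W setDE subsetIr.
  have etaU : eta * n <= #|U|%:R by rewrite Ua ltW.
  have etaW : eta * n <= #|W|%:R.
    by apply: le_trans (ltW a_gt) _; rewrite ler_nat.
  have gamma_eta_n := ler_wpM2r (ltW n_gt0) gamma_eta.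
  have [pUW_gt0 lo _] := count_edges U W dUW
    (le_trans gamma_eta_n etaU) (le_trans gamma_eta_n etaW).
  have wU x i : x \in U -> w x i = w u i.
    by move=> /(subsetP Uu); rewrite inE => /eqP; apply: fw.
  have wW x i : x \in W -> w x i = w v i.
    by rewrite !inE => /andP[_ /eqP]; apply: fw.
  (* One of the two roundings is 0 and the other at most 1, so [g i] is at most [t i - 1] on one set
     and [2 D - t i - 1] on the other, just below a cover. *)
  have sparse i : (nb_edges (h i) U W)%:R <= kappa * p * #|U|%:R * #|W|%:R.
    have [_ _ _ gi] := gs i; apply: ltW.
    have wi : (w u i + w v i <= 1)%N by rewrite leqNgt; apply/negP => ?; apply: no_i; exists i.
    have ti := tD i.
    have round0 x : w x i = 0%N -> (g i x <= (t i).-1)%N.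
      by rewrite /w /rounding; clear -ti; lia.
    have round1 x : (w x i <= 1)%N -> (g i x <= 2 * D - t i - 1)%N.
      by rewrite /w /rounding; clear -ti; lia.
    have t_gt0 x : w x i = 0%N -> (0 < t i)%N.
      by rewrite /w /rounding; clear; lia.
    case Eu: (w u i) wi => [|wu] wi.
      apply: (gi (t i).-1 (2 * D - t i - 1)%N) => //.
      - by move: (t_gt0 u Eu); clear -ti; lia.
      - by move=> x /(wU x i) wx; apply: round0; rewrite wx.
      - by move=> x /(wW x i) wx; apply: round1; rewrite wx; clear -wi; lia.
    have Ev : w v i = 0%N by clear -wi; lia.
    apply: (gi (2 * D - t i - 1)%N (t i).-1) => //.
    - by move: (t_gt0 v Ev); clear -ti; lia.
    - by move=> x /(wU x i) wx; apply: round1; rewrite wx Eu; clear -wi; lia.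
    - by move=> x /(wW x i) wx; apply: round0; rewrite wx.
  have colours : nb_edges G U W = (\sum_i nb_edges (h i) U W)%N.
    rewrite /nb_edges [RHS]exchange_big; apply: eq_bigr => x _.
    rewrite [RHS]exchange_big; apply: eq_bigr => y _.
    rewrite (bigD1 (c [set x; y])) //= /h eqxx andbT big1 ?addn0 // => i.
    by rewrite eq_sym => /negPf ->; rewrite andbF.
  have : (nb_edges G U W)%:R <= r%:R * (kappa * p * #|U|%:R * #|W|%:R).
    rewrite colours natr_sum; apply: le_trans (ler_sum _ (fun i _ => sparse i)) _.
    by rewrite sumr_const card_ord mulr_natl.
  have -> : r%:R * (kappa * p * #|U|%:R * #|W|%:R)
      = 4 * r%:R * kappa * (p * #|U|%:R * #|W|%:R) / 4 by field.
  by rewrite kappa_r; clear -lo pUW_gt0; lra.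

(* The final count over [r + 1] covers *)
have [i wi] := intersecting_colour r_gt0 meet.
pose X k := (\sum_v w v k)%N.
have X_small k : (X k)%:R <= (2 / (r%:R + 1) - eps) * n + 1 + 2 * e * n.
  have [_ _ sum_g _] := gs k.
  have D_gt0R : 0 < D%:R :> R by rewrite ltr0n.
  rewrite -(ler_pM2l D_gt0R).
  have : D%:R * (X k)%:R <= (\sum_v g k v)%:R + n.
    by rewrite -natrM -natrD ler_nat; apply: sum_t.
  have := ler_wpM2l (ltW D_gt0R) (s_short k).
  have := ler_wpM2r (ltW n_gt0) eD.
  by clear -sum_g; lra.
have XS : (2 * #|S| <= \sum_k X k + X i)%N.
  rewrite mulnC -sum_nat_const /X exchange_big -big_split [leqRHS](bigID (mem S)) /=.
  by apply: leq_trans (leq_addr _ _); apply: leq_sum => v; apply: wi.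
have total : 2 * n <= (r%:R + 1) * ((2 / (r%:R + 1) - eps) * n + 1 + 2 * e * n) + M%:R * a%:R.
  have : (2 * #|T| <= \sum_k X k + X i + M * a)%N.
    by rewrite /M expnS; clear -cardS XS; move: (4 ^ r)%N cardS => b; lia.
  rewrite -(ler_nat R) !natrD !natrM natr_sum -/n.
  have : \sum_k (X k)%:R <= r%:R * ((2 / (r%:R + 1) - eps) * n + 1 + 2 * e * n).
    apply: le_trans (ler_sum _ (fun k _ => X_small k)) _.
    by rewrite sumr_const card_ord -[leLHS]mulr_natl.
  by have := X_small i; clear; lra.
have Ma := ler_wpM2l (ltW M_gt0) a_le1.
have eta_Mn := ler_wpM2r (ltW n_gt0) eta_M.
have r1 : (r%:R + 1) * (2 / (r%:R + 1)) = 2 :> R by field; rewrite gt_eqF // addr_gt0.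
(* As [e = eps / 8], each cover falls short by [3 / 4 * (eps * n) - 1]; this outweighs the rare
   types, which cost at most [3 / 8 * (eps * n)]. *)
have : (r%:R + 1) * ((2 / (r%:R + 1) - eps) * n + 1 + 2 * e * n)
  = 2 * n + (r%:R + 1) * (1 - 3 / 4 * (eps * n)).
  by rewrite -[X in X * n + _]r1 /e; field; rewrite gt_eqF // addr_gt0.
have r_ge0 : 0 <= r%:R :> R by [].
have := ler_wpM2l r_ge0 epsn8.
by lra.
Qed.
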